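(* Let $n\ge 1$, let $w_1,\ldots,w_n$ be positive real numbers with $\sum_{j=1}^n w_j\ge 1$, and let $\alpha_j,\beta_j$ be real numbers with $0<\alpha_j<\beta_j$ for all $j=1,\ldots,n$. Let $b_0:=1$ and $b_k:=\sum_{j=1}^n w_j\,t(\beta_j,k)/t(\alpha_j,k)$ for $k\ge 1$. Then $\lim_{k\to\infty}b_k^{1/k}=1$.
   Context: For real $\gamma>0$, $t(\gamma,0)=1$ and $t(\gamma,k)=\dfrac{\gamma(\gamma+1)\cdots(\gamma+k-1)}{k!}$ for $k=1,2,\ldots$. *)

(* Defs.v *)
From mathcomp Require Import all_boot all_order all_algebra.
From mathcomp Require Import all_classical all_reals all_analysis.

Set Implicit Arguments.
Unset Strict Implicit.
Unset Printing Implicit Defensive.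

Import Order.TTheory GRing.Theory Num.Theory.
Import numFieldNormedType.Exports.

Local Open Scope classical_set_scope.
Local Open Scope ring_scope.

(* The empty product gives [tcoef gamma 0 = 1]. *)
Definition tcoef (R : realType) (gamma : R) (k : nat) : R :=
  (\prod_(i < k) (gamma + i%:R)) / k`!%:R.

(* The value at [k = 0] is 1 by convention, not the sum of the weights. *)
Definition bcoef (R : realType) (n : nat) (w alpha beta : 'I_n -> R)
    (k : nat) : R :=
  if k == 0%N then 1
  else \sum_(j < n) w j * (tcoef (beta j) k / tcoef (alpha j) k).

(* Main.v *)
(* Each summand of [b_(k+1)] is the corresponding summand of [b_k] times
   [(beta_j + k) / (alpha_j + k)], a factor that exceeds 1 and tends to 1. Hence
   [b_k >= \sum_j w_j >= 1], while for every [e > 0] the sequence eventually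
   grows by a factor of at most [1 + e] per step, which bounds the upper limit
   of the k-th roots by [1 + e]. *)
Require Import Defs.
From mathcomp Require Import all_boot all_order all_algebra.
From mathcomp Require Import all_classical all_reals all_analysis.
From mathcomp Require Import lra.

Set Implicit Arguments.
Unset Strict Implicit.
Unset Printing Implicit Defensive.

Import Order.TTheory GRing.Theory Num.Theory.
Import numFieldNormedType.Exports.

Local Open Scope classical_set_scope.
Local Open Scope ring_scope.

Lemma ratio_le_geometric (R : realType) (b : nat -> R) (q : R) (N : nat) :
  0 <= q -> (forall k, (N <= k)%N -> b k.+1 <= q * b k) ->
  forall m, b (m + N)%N <= q ^+ m * b N.
Proof.
move=> q0 bq; elim=> [|m IHm]; first by rewrite expr0 mul1r.
rewrite addSn exprS -mulrA; apply: le_trans (bq _ (leq_addl _ _)) _.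
exact: ler_wpM2l.
Qed.

Lemma cvg_root_of_ratio (R : realType) (b : nat -> R) :
  (forall k, 1 <= b k) ->
  (forall e, 0 < e -> \forall k \near \oo, b k.+1 <= (1 + e) * b k) ->
  (fun k : nat => b k `^ (k%:R^-1)) @ \oo --> (1 : R).
Proof.
move=> b1 ratio; apply/cvgrPdist_le => e e0.
have e20 : 0 < e / 2 by lra.
have [N _ HN] := ratio _ e20.
(* The growth bound holds only from [N] on, so it leaves a factor [b N]. Using the rate [p],
   strictly below [1 + e], makes [q < 1], and [b N * q ^+ k] then drops below 1. *)
set p := 1 + e / 2; set q := p / (1 + e).
have p1 : 1 <= p by rewrite /p; lra.
have p0 : 0 <= p by lra.
have q0 : 0 <= q by rewrite /q divr_ge0 //; lra.
have q1 : `|q| < 1.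
  by rewrite ger0_norm // /q ltr_pdivrMr; rewrite /p; lra.
have : (fun k => b N * q ^+ k) @ \oo --> b N * 0 by apply: cvgMl_tmp; exact: cvg_expr.
rewrite mulr0 => /cvgr_lt /(_ 1 ltr01) small.
near=> k.
have Nk : (N <= k)%N by near: k; exact: nbhs_infty_ge.
have k0 : (0 < k)%N by near: k; exact: nbhs_infty_gt.
have bk : b k <= (1 + e) ^+ k.
  have bp : b k <= p ^+ k * b N.
    (* There are only [k - N] growth steps; since [p >= 1], the exponent may be raised to [k]. *)
    rewrite -{1}(subnK Nk); apply: le_trans (ratio_le_geometric p0 HN _) _.
    apply: ler_wpM2r; first exact: le_trans (b1 N).
    by apply: ler_weXn2l => //; exact: leq_subr.
  apply: le_trans bp _.
  have : b N * q ^+ k < 1 by near: k.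
  rewrite /q expr_div_n mulrA ltr_pdivrMr ?mul1r; last by rewrite exprn_gt0 //; lra.
  by rewrite mulrC => /ltW.
have root_ge : 1 <= b k `^ k%:R^-1.
  rewrite -[leLHS](_ : 1 `^ k%:R^-1 = 1); last by rewrite powR1.
  apply: ge0_ler_powR; rewrite ?invr_ge0 ?ler0n ?nnegrE //.
  exact: le_trans (b1 k).
have root_le : b k `^ k%:R^-1 <= 1 + e.
  have -> : 1 + e = ((1 + e) ^+ k) `^ k%:R^-1.
    rewrite -powR_mulrn; last lra.
    by rewrite -powRrM mulfV ?powRr1 ?pnatr_eq0 -?lt0n //; lra.
  apply: ge0_ler_powR; rewrite ?invr_ge0 ?ler0n ?nnegrE //.
    exact: le_trans (b1 k).
  by apply: exprn_ge0; lra.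
rewrite distrC ger0_norm; lra.
Unshelve. all: by end_near.
Qed.

(** The factorials cancel, so passing from [k] to [k.+1] multiplies by a single factor. *)
Lemma tcoef_ratioE (R : realType) (alpha beta : R) (k : nat) :
  tcoef beta k / tcoef alpha k =
  \prod_(i < k) ((beta + i%:R) / (alpha + i%:R)).
Proof.
rewrite /tcoef prodf_div invf_div mulrA divfK // pnatr_eq0 -lt0n.
Qed.

Lemma tcoef_ratio_ge1 (R : realType) (alpha beta : R) (k : nat) :
  0 < alpha -> alpha <= beta -> 1 <= tcoef beta k / tcoef alpha k.
Proof.
move=> a0 ab; rewrite tcoef_ratioE.
elim: k => [|k IHk]; first by rewrite big_ord0.
rewrite big_ord_recr /= mulr_ege1 // ler_pdivlMr ?mul1r ?lerD2r //.
exact: ltr_wpDr.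
Qed.

Lemma tcoef_ratioS_le (R : realType) (alpha beta e : R) (k : nat) :
  0 < alpha -> alpha <= beta -> 0 <= e -> beta <= e * k%:R ->
  tcoef beta k.+1 / tcoef alpha k.+1 <=
  (1 + e) * (tcoef beta k / tcoef alpha k).
Proof.
move=> a0 ab e0 bk; have := tcoef_ratio_ge1 k a0 ab.
rewrite !tcoef_ratioE big_ord_recr /= => /(le_trans ler01) P0.
rewrite mulrC; apply: ler_wpM2r => //.
have ? : 0 < alpha + k%:R by exact: ltr_wpDr.
(* With the denominator cleared, [beta <= e * k%:R] pays for [beta], and the remaining terms [alpha]
   and [e * alpha] are nonnegative. *)
rewrite ler_pdivrMr // mulrDl mul1r mulrDr.
have : 0 <= e * alpha by apply: mulr_ge0 => //; exact: ltW.
lra.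
Qed.

Theorem corollary3 (R : realType) (n : nat) (w alpha beta : 'I_n -> R)
    (hn : (1 <= n)%N)
    (hw : forall j, 0 < w j)
    (hsum : 1 <= \sum_(j < n) w j)
    (halpha : forall j, 0 < alpha j)
    (hbeta : forall j, alpha j < beta j) :
  (fun k : nat => bcoef w alpha beta k `^ (k%:R^-1)) @ \oo --> (1 : R).
Proof.
apply: cvg_root_of_ratio => [k|e e0].
  rewrite /bcoef; case: eqP => // _; apply: le_trans hsum _.
  apply: ler_sum => j _; rewrite ler_peMr ?(ltW (hw j)) //.
  exact: tcoef_ratio_ge1 (ltW (hbeta j)).
near=> k.
(* At index 0 the value of [bcoef] is the convention 1, not the sum, so the termwise comparison
   starts at [k = 1]. *)
have k0 : (0 < k)%N by near: k; exact: nbhs_infty_gt.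
have beta0 j : 0 <= beta j by apply: ltW; exact: lt_trans (hbeta j).
have beta_le j : beta j <= e * k%:R.
  (* The sum of all [beta i] dominates each one, which gives a threshold for [k] independent of
     [j]. *)
  apply: (@le_trans _ _ (\sum_(i < n) beta i)).
    by rewrite (bigD1 j) //= lerDl sumr_ge0.
  rewrite mulrC -ler_pdivrMr //.
  by near: k; exact: nbhs_infty_ger.
rewrite /bcoef /= gtn_eqF // mulr_sumr; apply: ler_sum => j _.
rewrite [leRHS]mulrCA; apply: ler_wpM2l; first exact: ltW.
by apply: tcoef_ratioS_le => //; exact: ltW.
Unshelve. all: by end_near.
Qed.
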